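(* Let $\mathcal{X}$ be a Polish space with its Borel $\sigma$-algebra, let $\mu$ be a probability measure on $\mathcal{X}$, and let $\mathcal{Y}=\mathbb{R}^d$. Suppose that $A\subset\mathcal{Y}$ is nonempty, bounded, and equal to the closure of its interior, and that $\gamma$ is the uniform distribution on $A$ (normalized Lebesgue measure restricted to $A$). Let $F:\mathcal{X}\times\mathcal{Y}\to\mathbb{R}$ be Borel measurable, bounded from below, and such that $y\mapsto F(x,y)$ is lower semicontinuous for each $x\in\mathcal{X}$. For $c\in(0,\infty)$ define $$\Lambda_c^1=\frac1c\log\int_{\mathcal{Y}}\exp\left(\int_{\mathcal{X}}cF(x,y)\mu(dx)\right)\gamma(dy)$$ and let $\Lambda_\infty^1=\lim_{c\to\infty}\Lambda_c^1$. Then $$\sup_{y\in A}\int_{\mathcal{X}}F(x,y)\mu(dx)=\Lambda_\infty^1 .$$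
   Context: All quantities may take the value $+\infty$, with the conventions $e^{\infty}=\infty$ and $\log\infty=\infty$; the limit $\Lambda_\infty^1$ is taken in $(-\infty,\infty]$, and the asserted equality includes the case where both sides equal $+\infty$. *)

(* Defs.v *)
From HB Require Import structures.
From mathcomp Require Export all_boot all_order all_algebra.
From mathcomp Require Export all_classical all_reals all_analysis.
From mathcomp Require Import lra.
Export Order.TTheory GRing.Theory Num.Theory.
Export numFieldNormedType.Exports.

Set Implicit Arguments.
Unset Strict Implicit.
Unset Printing Implicit Defensive.

Local Open Scope classical_set_scope.
Local Open Scope ring_scope.

Notation borel T := (g_sigma_algebraType (@open T%type)).

Section polish.
Variables (R : realType) (T : topologicalType).
Implicit Type dist : T -> T -> R.

Definition is_metric dist :=
  [/\ forall x y, dist x y = 0 <-> x = y,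
      forall x y, dist x y = dist y x &
      forall x y z, dist x z <= dist x y + dist y z].

Definition induces_topology dist := forall (x : T) (U : set T),
  nbhs x U <-> exists2 e : R, 0 < e & [set y | dist x y < e] `<=` U.

Definition complete_metric dist := forall u : nat -> T,
  (forall e : R, 0 < e -> exists N : nat, forall m n : nat,
    (N <= m)%N -> (N <= n)%N -> dist (u m) (u n) < e) ->
  exists l : T, u @ \oo --> l.

Definition separable_space := exists2 D : set T, countable D & dense D.

(* The metric is only required to exist; it is not part of the structure. *)
Definition polish := separable_space /\
  exists dist, [/\ is_metric dist, induces_topology dist & complete_metric dist].

End polish.

Section lebesgue_rV.
Variable R : realType.
Local Notation RT := (measurableTypeR R).

Definition tuple_cons n (p : n.-tuple RT * RT) : n.+1.-tuple RT :=
  [tuple of p.2 :: p.1].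

Lemma tnth_tuple_cons0 n p : tnth (@tuple_cons n p) ord0 = p.2.
Proof. exact: tnth0. Qed.

Lemma tnth_tuple_consS n p i : tnth (@tuple_cons n p) (lift ord0 i) = tnth p.1 i.
Proof. exact: tnthS. Qed.

Lemma measurable_tuple_cons n : measurable_fun setT (@tuple_cons n).
Proof. exact: measurable_cons. Qed.

(* The n-fold product of the one-dimensional Lebesgue measure. *)
Fixpoint lebesgue_tuple n : {measure set (n.-tuple RT) -> \bar R} :=
  match n with
  | 0 => \d_([tuple] : 0.-tuple RT)
  | m.+1 => measure_function_pushforward__canonical__measure_function_Measure
              (lebesgue_tuple m \x @lebesgue_measure R)%E
              (@measurable_tuple_cons m)
  end.

Definition row_of_tuple n (t : n.-tuple RT) : borel 'rV[R]_n :=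
  \row_i (tnth t i : R).

Lemma open_rV_boxes n (U : set 'rV[R]_n) : open U ->
  U = \bigcup_(q in [set q : 'rV[rat]_n * 'rV[rat]_n |
        [set v : 'rV[R]_n | forall i, ratr (q.1 0 i) < v 0 i < ratr (q.2 0 i)]
          `<=` U])
      [set v | forall i, ratr (q.1 0 i) < v 0 i < ratr (q.2 0 i)].
Proof.
move=> oU; apply/seteqP; split; last by move=> v [q /= qU vq]; exact: qU.
move=> v Uv.
have : nbhs v U by apply: open_nbhs_nbhs.
move=> /nbhs_ballP[e /= e0 veU].
have e2 : 0 < e / 2 by rewrite divr_gt0.
have lo i : exists q : rat, v 0 i - e / 2 < ratr q < v 0 i.
  have /rat_in_itvoo[q] : v 0 i - e / 2 < v 0 i by rewrite ltrBlDr ltrDl.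
  by rewrite in_itv/= => ?; exists q.
have hi i : exists q : rat, v 0 i < ratr q < v 0 i + e / 2.
  have /rat_in_itvoo[q] : v 0 i < v 0 i + e / 2 by rewrite ltrDl.
  by rewrite in_itv/= => ?; exists q.
have [a av] := choice lo; have [b bv] := choice hi.
exists (\row_i a i, \row_i b i) => /=; last first.
  by move=> i; rewrite !mxE; have /andP[_ ->] := av i; have /andP[-> _] := bv i.
move=> w /= wab; apply: veU; split => // i j.
rewrite ord1; have := wab j; rewrite !mxE.
have := av j; have := bv j; rewrite /ball/= ltr_norml.
by move=> /andP[? ?] /andP[? ?] /andP[? ?]; apply/andP; split; lra.
Qed.

Lemma measurable_row_of_tuple n : measurable_fun setT (@row_of_tuple n).
Proof.
apply: (@measurability _ _ _ (borel 'rV[R]_n) _ _ (@open 'rV[R]_n)) => //.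
move=> _ [U oU <-]; rewrite setTI (open_rV_boxes oU) preimage_bigcup.
rewrite bigcup_mkcond; apply: countable_bigcupT_measurable => [|q].
  exact: countableP.
case: ifPn => // _.
rewrite (_ : _ @^-1` _ = \big[setI/setT]_(i < n)
  ((fun t : n.-tuple RT => tnth t i) @^-1`
    `](ratr (q.1 0 i)), (ratr (q.2 0 i))[)).
  apply: bigsetI_measurable => i _.
  rewrite -[X in measurable X]setTI; apply: measurable_tnth; first exact: measurableT.
  exact: measurable_itv.
rewrite -bigcap_seq; apply/seteqP; split => t /= H i.
  by move=> _; have := H i; rewrite mxE /= in_itv.
by have := H i (mem_index_enum _); rewrite /= in_itv mxE.
Qed.

(* d-dimensional Lebesgue measure on the Borel sets of R^d, realized as row
   vectors. The lemma [lebesgue_rV_box] gives its value on boxes. *)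
Definition lebesgue_rV n : {measure set (borel 'rV[R]_n) -> \bar R} :=
  measure_function_pushforward__canonical__measure_function_Measure
    (lebesgue_tuple n) (@measurable_row_of_tuple n).

Lemma lebesgue_tuple_box n (B : 'I_n -> set RT) :
  (forall i, measurable (B i)) ->
  lebesgue_tuple n [set t | forall i, B i (tnth t i)] =
  (\prod_(i < n) lebesgue_measure (B i))%E.
Proof.
elim: n B => [|n IH] B mB.
  rewrite big_ord0 /= diracE mem_set//.
  by case.
rewrite big_ord_recl muleC -IH//= -product_measure1E//; last first.
  rewrite (_ : mkset _ = \big[setI/setT]_(i < n)
    ((fun t : n.-tuple RT => tnth t i) @^-1` B (lift ord0 i))).
    apply: bigsetI_measurable => i _.
    by rewrite -[X in measurable X]setTI; exact: measurable_tnth.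
  rewrite -bigcap_seq; apply/seteqP; split => t /= H i; first by move=> _; exact: H.
  exact: (H i (mem_index_enum _)).
rewrite /pushforward; congr (_ _); apply/seteqP; split => -[t x] /=.
  move=> H; split => [i|]; first by have := H (lift ord0 i); rewrite tnth_tuple_consS.
  by have := H ord0; rewrite tnth_tuple_cons0.
move=> [H Bx] i; have [j ->|->] := unliftP ord0 i; last by rewrite tnth_tuple_cons0.
by rewrite tnth_tuple_consS; exact: H.
Qed.

Lemma lebesgue_rV_box n (B : 'I_n -> set RT) :
  (forall i, measurable (B i)) ->
  lebesgue_rV n [set v | forall i, B i (v 0 i)] =
  (\prod_(i < n) lebesgue_measure (B i))%E.
Proof.
move=> mB; rewrite -lebesgue_tuple_box//= /pushforward; congr (_ _).
by apply/seteqP; split => t /= H i; have := H i; rewrite mxE.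
Qed.

End lebesgue_rV.

Section uniform_lambda.
Variable R : realType.

Definition uniform_on n (A : set 'rV[R]_n)
    (gamma : probability (borel 'rV[R]_n) R) :=
  forall B : set (borel 'rV[R]_n), measurable B ->
    (gamma B = lebesgue_rV R n (A `&` B) / lebesgue_rV R n A)%E.

Variables (X : ptopologicalType) (n : nat).
Variables (mu : probability (borel X) R).
Variables (gamma : probability (borel 'rV[R]_n) R).
Variable F : X * 'rV[R]_n -> R.
Local Open Scope ereal_scope.

(* [expeR +oo = +oo] and [lne +oo = +oo]. *)
Definition Lambda1 (c : R) : \bar R :=
  c^-1%:E * lne (\int[gamma]_y expeR (\int[mu]_x (c * F (x, y))%:E)).

(* [lim] is total: existence of this limit has to be asserted separately. *)
Definition Lambda1_infty : \bar R := lim (Lambda1 c @[c --> +oo%R]).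

End uniform_lambda.

(* Main.v *)
(* Put g y := \int F(x, y) mu(dx). By Fatou's lemma g is lower semicontinuous, F
   being bounded below. Since gamma is carried by A, Lambda_c <= sup_A g for all
   c > 0. Conversely, if b < sup_A g then {g > b} is an open set meeting A, hence
   the interior of A, which is dense in A; so U := interior A `&` {g > b} is open,
   nonempty, and has gamma U > 0, whence Lambda_c >= b + ln (gamma U) / c. *)
Require Import Defs.
From mathcomp Require Import lra measurable_realfun.

Set Implicit Arguments.
Unset Strict Implicit.
Unset Printing Implicit Defensive.

Local Open Scope classical_set_scope.
Local Open Scope ring_scope.

(** The integral of [f] may be [+oo], so linearity for integrable functions does not apply. The
    shift makes facts about nonnegative functions available; [m] integrates to itself because [mu]
    has mass one. *)
Lemma integral_subr_lbounded d (T : measurableType d) (R : realType)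
    (mu : probability T R) (f : T -> R) (m : R) :
  measurable_fun setT f -> (forall x, m <= f x) ->
  (\int[mu]_x (f x)%:E = \int[mu]_x (f x - m)%:E + m%:E)%E.
Proof.
move=> mf fm.
have mEf : measurable_fun setT (EFin \o f) by exact/measurable_EFinP.
have mfm : measurable_fun setT (fun x => (f x - m)%:E).
  by apply/measurable_EFinP; exact: measurable_funB.
have intc (a : R) : (\int[mu]_x a%:E = a%:E)%E.
  rewrite integral_cst// -[RHS]mule1; congr (_ * _)%E.
  exact: probability_setT.
have maxE (r : R) : maxe r%:E 0 = (Num.max r 0)%:E by rewrite EFin_max.
(* With m = p - q and p, q >= 0, add p + f^- to both sides so that only
   nonnegative functions are integrated. *)
pose p := Num.max 0 m; pose q := Num.max 0 (- m).
have p0 : 0 <= p by rewrite le_max lexx.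
have q0 : 0 <= q by rewrite le_max lexx.
have pq : m = p - q.
  by rewrite /p /q; have [m0|m0] := leP 0 m; rewrite ?oppr_le0; case: leP => ?; lra.
rewrite [LHS]integralE.
set Jp := (\int[mu]_x (fun y => (f y)%:E)^\+ x)%E.
set Jn := (\int[mu]_x (fun y => (f y)%:E)^\- x)%E.
have mfp := measurable_funepos mEf.
have mfn := measurable_funeneg mEf.
(* The lower bound caps the negative part by [q], so [Jn] is finite and may be cancelled. *)
have Jnq : (Jn <= q%:E)%E.
  rewrite -(intc q); apply: ge0_le_integral => //.
  move=> x _; rewrite funenegE maxE lee_fin /q.
  by rewrite ge_max !le_max lerN2 fm lexx orbT.
have Jn_fin : Jn \is a fin_num.
  by rewrite ge0_fin_numE ?integral_ge0// (le_lt_trans Jnq) ?ltry.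
have key : (\int[mu]_x (f x - m)%:E + p%:E + Jn = Jp + q%:E)%E.
  rewrite -(intc p) -(intc q) -!ge0_integralD//=.
  - apply: eq_integral => x _.
    rewrite funeposE funenegE !maxE -!EFinD pq; congr EFin.
    by case: (leP (f x) 0) => ?; case: leP => ?; lra.
  - by move=> x _; rewrite -EFinD lee_fin; have := fm x; lra.
  - by apply: emeasurable_funD.
  - by move=> x _; rewrite lee_fin subr_ge0.
rewrite (_ : Jp = \int[mu]_x (f x - m)%:E + p%:E + Jn - q%:E)%E; last first.
  by rewrite key addeK.
rewrite pq -(fineK Jn_fin); move: (integral _ _ _) => I.
rewrite -!addeA; congr (I + _)%E.
by rewrite -!EFinN -!EFinD; congr EFin; lra.
Qed.

(** Balls of radius [1/(n+1)] turn a failure at [y] into a sequence [u] converging to [y] with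
    integrals at most [a]; Fatou's lemma along [u] contradicts this. *)
Lemma lower_semicontinuous_integral d (T : measurableType d) (R : realType)
    (Y : pseudoMetricType R) (mu : {measure set T -> \bar R})
    (f : T -> Y -> R) :
  (forall y, measurable_fun setT (f^~ y)) -> (forall x y, 0 <= f x y) ->
  (forall x, lower_semicontinuous (fun y => (f x y)%:E)) ->
  lower_semicontinuous (fun y => \int[mu]_x (f x y)%:E)%E.
Proof.
move=> mf f0 flsc y a ay; apply: contrapT => notlsc.
have /choice[u uP] (n : nat) : exists z,
    ball y n.+1%:R^-1 z /\ (\int[mu]_x (f x z)%:E <= a%:E)%E.
  apply: contrapT => nz; apply: notlsc; exists (ball y n.+1%:R^-1).
    by apply: nbhsx_ballx; rewrite invr_gt0.
  by move=> z yz; rewrite ltNge; apply/negP => za; apply: nz; exists z.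
have uy : u @ \oo --> y.
  apply/cvg_ballP => e e0.
  near=> n; apply: le_ball (uP n).1.
  by near: n; apply: filterS (near_infty_natSinv_lt (PosNum e0)) => n /ltW.
have fle x : ((f x y)%:E <= limn_einf (fun n => (f x (u n))%:E))%E.
  rewrite limn_einf_lim; apply/lee_subgt0Pr => e e0.
  have [|V yV VP] := flsc x y (f x y - e).
    by rewrite lte_fin; lra.
  have [N _ NV] := uy _ yV.
  apply: lime_ge; first exact: is_cvg_einfs.
  exists N => // n /= Nn; apply: le_ereal_inf_tmp => _ [k /= nk <-].
  by apply/ltW/VP/NV; exact: leq_trans nk.
(* Each tail infimum is at most the first term of its tail. *)
have : (limn_einf (fun n => \int[mu]_x (f x (u n))%:E) <= a%:E)%E.
  rewrite limn_einf_lim; apply: lime_le; first exact: is_cvg_einfs.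
  apply: nearW => n; apply: (@le_trans _ _ (\int[mu]_x (f x (u n))%:E)%E).
    by apply: ereal_inf_lbound; exists n => /=.
  exact: (uP n).2.
apply/negP; rewrite -ltNge (lt_le_trans ay)//.
apply: (@le_trans _ _ (\int[mu]_x limn_einf (fun n => (f x (u n))%:E))%E); last first.
  by apply: fatou => // n; [apply/measurable_EFinP; exact: mf|move=> x _; rewrite lee_fin].
apply: ge0_le_integral => //.
- by move=> x _; rewrite lee_fin.
- by apply/measurable_EFinP; exact: mf.
(* The lower limit is by definition the opposite of the upper limit of the opposites. *)
- apply: measurableT_comp; first exact: oppe_measurable.
  apply: measurable_fun_limn_esup => n; apply: measurableT_comp.
    exact: oppe_measurable.
  by apply/measurable_EFinP; exact: mf.
Unshelve. all: by end_near. Qed.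

Lemma lower_semicontinuous_measurable_borel (R : realType)
    (Y : ptopologicalType) (f : Y -> \bar R) :
  lower_semicontinuous f ->
  measurable_fun [set: borel Y] (f : borel Y -> \bar R).
Proof.
move=> /lower_semicontinuousP flsc.
apply: (measurability _ (ErealGenOInfty.measurableE R)).
move=> /= _ [_ [a ->]] <-; rewrite setTI preimage_itvoy.
by apply: sub_gen_smallest; exact: flsc.
Qed.

Lemma lower_semicontinuous_expeR (R : realType) (Y : topologicalType)
    (f : Y -> \bar R) :
  lower_semicontinuous f -> lower_semicontinuous (fun y => expeR (f y)).
Proof.
move=> flsc y a; have [a0|a0] := ltP 0 a.
  have -> : a%:E = expeR (ln a)%:E by rewrite /= lnK.
  rewrite lte_expeR => /flsc[V yV VP].
  by exists V => // z /VP; rewrite lte_expeR.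
(* For [a <= 0] there is no logarithm. If [f y = -oo], the exponential vanishes there, so [a < 0]
   and every point qualifies; otherwise [f] stays above some real near [y], where the exponential is
   positive. *)
have [fy ay|] := eqVneq (f y) -oo%E.
  exists setT => [|z _]; first exact: filterT.
  by rewrite (lt_le_trans ay)// fy expeR_ge0.
rewrite -ltNye => fy _.
have [b bfy] : exists b : R, (b%:E < f y)%E.
  case: (f y) fy => [r _|_|//]; last by exists 0; rewrite ltry.
  by exists (r - 1); rewrite lte_fin; lra.
have [V yV VP] := flsc _ _ bfy; exists V => // z /VP bz.
rewrite (@le_lt_trans _ _ 0%E) ?lee_fin// expeR_gt0//.
by rewrite (lt_trans _ bz)// ltNyr.
Qed.

(** A ball of the sup norm is a cube of side [2e], whose volume is given by the box formula. *)
Lemma lebesgue_rV_open_gt0 (R : realType) n (U : set 'rV[R]_n) :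
  open U -> U !=set0 -> (0 < lebesgue_rV R n U)%E.
Proof.
move=> oU [v Uv].
have : nbhs v U by exact: open_nbhs_nbhs.
move=> /nbhs_ballP[e /= e0 veU].
pose B (i : 'I_n) : set R := `](v 0 i - e), (v 0 i + e)[%classic.
have mB i : measurable (B i : set (measurableTypeR R)) by exact: measurable_itv.
have ballE : ball v e = [set w | forall i, B i (w 0 i)].
  apply/seteqP; split=> w /=.
    move=> [_ vw] i; have := vw 0 i; rewrite /B/= in_itv/= /ball/= ltr_norml.
    by move=> /andP[? ?]; apply/andP; split; lra.
  move=> wB; split => // i j; rewrite ord1.
  have := wB j; rewrite /B/= in_itv/= /ball/= ltr_norml => /andP[? ?].
  by apply/andP; split; lra.
apply: (@lt_le_trans _ _ (lebesgue_rV R n (ball v e))); last first.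
  by apply: le_measure; rewrite ?inE//; apply: sub_gen_smallest => //; exact: ball_open.
rewrite ballE lebesgue_rV_box//.
under eq_bigr => i _.
  rewrite lebesgue_measure_itv/= lte_fin ltrD2l gtrN// -EFinB.
  rewrite (_ : _ - _ = e *+ 2); last by rewrite mulr2n; lra.
  over.
by rewrite prodEFin lte_fin prodr_gt0// => i _; rewrite pmulrn_rgt0.
Qed.

(** This treats finite and infinite suprema together: for [M = +oo] the last hypothesis is
    divergence to [+oo], and for finite [M] the two bounds squeeze [f]. *)
Lemma cvge_le_near (R : realType) (f : R -> \bar R) (M : \bar R) :
  (-oo < M)%E -> (\forall c \near +oo, (f c <= M)%E) ->
  (forall a : R, (a%:E < M)%E -> \forall c \near +oo, (a%:E < f c)%E) ->
  f c @[c --> +oo] --> M.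
Proof.
case: M => [M| |//] _ fM faM.
  apply/fine_cvgP; split.
    have /faM fM1 : ((M - 1)%:E < M%:E)%E by rewrite lte_fin; lra.
    near=> c; rewrite fin_numElt; apply/andP; split.
      by apply: (@lt_trans _ _ (M - 1)%:E); [rewrite ltNyr|near: c].
    by apply: (@le_lt_trans _ _ M%:E); [near: c|rewrite ltry].
  apply/cvgrPdist_le => e e0.
  have /faM fMe : ((M - e)%:E < M%:E)%E by rewrite lte_fin; lra.
  near=> c.
  have : ((M - e)%:E < f c)%E by near: c.
  have : (f c <= M%:E)%E by near: c.
  rewrite /=; case: (f c) => // r; rewrite lte_fin lee_fin /= => ? ?.
  by rewrite ler_norml; apply/andP; split; lra.
by apply/cvgeyPgty; apply: nearW => a; apply: faM; rewrite ltry.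
Unshelve. all: by end_near. Qed.

(** The sigma-algebra on the product is generated by its open sets, so continuity of [x |-> (x, y)]
    suffices. *)
Lemma measurable_section_borel (R : realType) (X Y : ptopologicalType)
    (F : X * Y -> R) (y : Y) :
  measurable_fun [set: borel (X * Y)] F ->
  measurable_fun [set: borel X] (fun x => F (x, y)).
Proof.
move=> mF.
suff mpair : measurable_fun [set: borel X] (fun x => (x, y) : borel (X * Y)%type).
  exact: measurableT_comp mF mpair.
apply: (@measurability _ _ _ (borel (X * Y)%type) _ _ (@open (X * Y)%type)) => //.
move=> _ [U oU <-]; rewrite setTI; apply: sub_gen_smallest => /=.
apply: open_comp oU => x _; apply: cvg_pair => //=; exact: cvg_cst.
Qed.

(** Shifting [f] by [m] and [c * f] by [c * m] reduces this to scaling a nonnegative integrand, even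
    when the integrals are infinite. *)
Lemma integralZ_lbounded d (T : measurableType d) (R : realType)
    (mu : probability T R) (f : T -> R) (m c : R) :
  measurable_fun setT f -> (forall x, m <= f x) -> 0 <= c ->
  (\int[mu]_x (c * f x)%:E = c%:E * \int[mu]_x (f x)%:E)%E.
Proof.
have distr (I : \bar R) : (c%:E * (I + m%:E) = c%:E * I + (c * m)%:E)%E.
  by rewrite EFinM muleDr// fin_num_adde_defl.
move=> mf fm c0; rewrite (integral_subr_lbounded mu mf fm).
have mcf : measurable_fun setT (fun x => c * f x) by exact: measurable_funM.
rewrite (integral_subr_lbounded mu mcf (fun x => ler_wpM2l c0 (fm x))).
under eq_integral do rewrite -mulrBr EFinM.
rewrite ge0_integralZl ?lee_fin//.
- by apply/measurable_EFinP; exact: measurable_funB.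
- by move=> x _; rewrite lee_fin subr_ge0.
Qed.

Lemma lower_semicontinuous_integral_lbounded d (T : measurableType d) (R : realType)
    (Y : pseudoMetricType R) (mu : probability T R) (m : R)
    (f : T -> Y -> R) :
  (forall y, measurable_fun setT (f^~ y)) -> (forall x y, m <= f x y) ->
  (forall x, lower_semicontinuous (fun y => (f x y)%:E)) ->
  lower_semicontinuous (fun y => \int[mu]_x (f x y)%:E)%E.
Proof.
move=> mf fm flsc y a.
have shift z := integral_subr_lbounded mu (mf z) (fm^~ z).
rewrite shift -lteBlDr// -EFinB => ay.
have [V yV VP] : exists2 V, nbhs y V &
    forall z, V z -> ((a - m)%:E < \int[mu]_x (f x z - m)%:E)%E.
  apply: lower_semicontinuous_integral ay => [z|x z|x z b].
  - exact: measurable_funB.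
  - by rewrite subr_ge0.
  - rewrite EFinB lteBrDr// -EFinD => /flsc[V zV VP]; exists V => // w /VP.
    by rewrite EFinB lteBrDr// -EFinD.
by exists V => // z /VP; rewrite EFinB lteBlDr// shift.
Qed.

Lemma lower_semicontinuousZ (R : realType) (Y : topologicalType)
    (f : Y -> \bar R) (c : R) :
  0 < c -> lower_semicontinuous f ->
  lower_semicontinuous (fun y => c%:E * f y)%E.
Proof.
move=> c0 flsc y a; rewrite -lte_pdivrMl// -EFinM => /flsc[V yV VP].
by exists V => // z /VP; rewrite EFinM lte_pdivrMl.
Qed.

(** * Upper and lower bounds for the logarithm of an exponential integral *)

Section laplace.
Variables (R : realType) (d : measure_display) (Y : measurableType d).
Variables (gamma : probability Y R) (g : Y -> \bar R) (c : R).
Hypothesis c0 : (0 < c)%R.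
Hypothesis mg : measurable_fun setT (fun y => expeR (c%:E * g y)).
Local Open Scope ereal_scope.

Let L := c^-1%:E * lne (\int[gamma]_y expeR (c%:E * g y)).

Lemma log_laplace_le (A : set Y) (M : \bar R) :
  measurable A -> gamma (~` A) = 0 -> (forall y, A y -> g y <= M) ->
  L <= M.
Proof.
move=> mA A1 gM.
have expM_le y : A y -> expeR (c%:E * g y) <= expeR (c%:E * M).
  by move=> Ay; rewrite lee_expeR lee_pmul2l ?lte_fin// gM.
have : \int[gamma]_y expeR (c%:E * g y) <= expeR (c%:E * M).
  have mAC := measurableC mA.
  rewrite (ge0_negligible_integral mAC _ mg _ A1)//; last first.
    by move=> y _; exact: expeR_ge0.
  rewrite setTD setCK.
  apply: (@le_trans _ _ (\int[gamma]_(y in A) expeR (c%:E * M))).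
    apply: ge0_le_integral => //.
      by move=> y _; exact: expeR_ge0.
    by apply: measurable_funTS; exact: mg.
  rewrite integral_cst// -[leRHS]mule1 lee_wpmul2l ?expeR_ge0//.
  exact: probability_le1.
set I := integral _ _ _ => IM.
have I0 : 0 <= I by apply: integral_ge0 => y _; exact: expeR_ge0.
(* Writing [M] as [c^-1 * (c * M)] cancels the factor [c^-1]; [expeR] then undoes [lne] on
   [[0, +oo]]. *)
rewrite /L -/I -[leRHS]mul1e -(mulVf (lt0r_neq0 c0)) EFinM -muleA.
rewrite lee_pmul2l ?lte_fin ?invr_gt0//.
by rewrite -lee_expeR lneK ?in_itv/= ?I0 ?leey.
Qed.

(** Keeping only the contribution of [U] bounds the integral below by [expR (c * a) * gamma U]; the
    logarithm turns the mass into a correction of order [1/c]. *)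
Lemma log_laplace_ge (U : set Y) (a : R) :
  measurable U -> 0 < gamma U -> (forall y, U y -> a%:E <= g y) ->
  (a + c^-1 * ln (fine (gamma U)))%:E <= L.
Proof.
move=> mU U0 ag.
have Ufin : gamma U \is a fin_num by exact: fin_num_measure.
have Up0 : (0 < fine (gamma U))%R by rewrite fine_gt0// U0 ltey_eq Ufin.
have : (expR (c * a))%:E * gamma U <= \int[gamma]_y expeR (c%:E * g y).
  rewrite -integral_cst//.
  apply: (@le_trans _ _ (\int[gamma]_(y in U) expeR (c%:E * g y))).
    apply: ge0_le_integral => //=.
    - by apply: measurable_funTS; exact: mg.
    - move=> y Uy; rewrite (_ : (expR _)%:E = expeR (c%:E * a%:E))//.
      by rewrite lee_expeR lee_pmul2l ?lte_fin// ag.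
  by apply: ge0_subset_integral => // y _; exact: expeR_ge0.
set I := integral _ _ _ => IM.
have I0 : 0 <= I by apply: integral_ge0 => y _; exact: expeR_ge0.
rewrite /L -/I.
rewrite (_ : (a + _)%R = c^-1 * (c * a + ln (fine (gamma U))))%R; last first.
  by rewrite mulrDr mulrA mulVf ?mul1r// lt0r_neq0.
rewrite EFinM lee_pmul2l ?lte_fin ?invr_gt0//.
rewrite -lee_expeR lneK ?in_itv/= ?I0 ?leey//.
by rewrite expRD lnK// EFinM fineK.
Qed.

End laplace.

(** * Convergence of [Lambda1] to the supremum over [A] *)

Unset Implicit Arguments.
Set Strict Implicit.

Theorem theorem4 (R : realType) (X : ptopologicalType) (d : nat)
    (mu : probability (borel X) R)
    (A : set 'rV[R]_d) (gamma : probability (borel 'rV[R]_d) R)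
    (F : X * 'rV[R]_d -> R)
    (polish_X : polish R X)
    (A_neq0 : A !=set0) (A_bounded : bounded_set A)
    (A_regular : A = closure (interior A))
    (gamma_uniform : uniform_on A gamma)
    (F_borel : measurable_fun [set: borel (X * 'rV[R]_d)] F)
    (F_bounded_below : has_lbound (range F))
    (F_lsc : forall x : X, lower_semicontinuous (fun y => (F (x, y))%:E)) :
  cvg (Lambda1 mu gamma F c @[c --> +oo]) /\
  ereal_sup [set \int[mu]_x (F (x, y))%:E | y in A]%E
    = Lambda1_infty mu gamma F.
Proof.
have [m Fm_] := F_bounded_below.
have Fm (x : borel X) (y : 'rV[R]_d) : m <= F (x, y) by apply: Fm_; exists (x, y).
have mF (y : 'rV[R]_d) := measurable_section_borel y F_borel.
pose g (y : 'rV[R]_d) : \bar R := (\int[mu]_x (F (x, y))%:E)%E.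
have glsc : lower_semicontinuous g.
  exact: (lower_semicontinuous_integral_lbounded mF Fm F_lsc).
suff : Lambda1 mu gamma F c @[c --> +oo] --> ereal_sup [set g y | y in A].
  by move=> cvgL; split; [apply/cvg_ex; eexists; exact: cvgL|exact/esym/cvg_lim].
have mexp c : 0 < c ->
    measurable_fun [set: borel 'rV[R]_d] (fun y => expeR (c%:E * g y))%E.
  move=> c0; apply: lower_semicontinuous_measurable_borel.
  exact/lower_semicontinuous_expeR/lower_semicontinuousZ.
have LE c : 0 < c -> Lambda1 mu gamma F c =
    (c^-1%:E * lne (\int[gamma]_y expeR (c%:E * g y)))%E.
  move=> c0; congr (_ * lne _)%E; apply: eq_integral => y _; congr expeR.
  by apply: integralZ_lbounded; [exact: mF|move=> x; exact: Fm|exact: ltW].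
have mA : measurable (A : set (borel 'rV[R]_d)).
  rewrite -[A]setCK; apply: measurableC; apply: sub_gen_smallest => /=.
  by rewrite openC A_regular; exact: closed_closure.
have gammaAC : gamma (~` A) = 0%E.
  by rewrite gamma_uniform ?setICr ?measure0 ?mul0e//; exact: measurableC.
have gamma_open U : open U -> U !=set0 -> U `<=` A -> (0 < gamma U)%E.
  move=> oU U0 UA; have mU : measurable (U : set (borel 'rV[R]_d)).
    exact: sub_gen_smallest.
  have lU := lebesgue_rV_open_gt0 oU U0.
  have lA : (0 < lebesgue_rV R d A)%E.
    by rewrite (lt_le_trans lU)// le_measure ?inE.
  (* Since the inverse of [+oo] is 0, infinite volume would give [gamma] total mass 0 instead of
     1. *)
  have lAy : lebesgue_rV R d A != +oo%E.
    apply/eqP => lAy; have := probability_setT gamma.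
    rewrite gamma_uniform//= lAy invey mule0 => /esym/eqP.
    by rewrite onee_eq0.
  rewrite gamma_uniform// setIidr// mule_gt0// inve_gt0// gt_eqF//.
apply: cvge_le_near.
- have [y Ay] := A_neq0.
  apply: (@lt_le_trans _ _ (g y)); last by apply: ereal_sup_ubound; exists y.
  rewrite (@lt_le_trans _ _ m%:E) ?ltNyr//.
  rewrite /g (integral_subr_lbounded mu (mF y) (Fm^~ y)).
  by rewrite leeDr// integral_ge0// => x _; rewrite lee_fin subr_ge0.
- near=> c; have c0 : 0 < c by near: c; exact: nbhs_pinfty_gt.
  rewrite LE//.
  apply: (log_laplace_le _ _ mA gammaAC) => //; first exact: mexp.
  by move=> y Ay; apply: ereal_sup_ubound; exists y.
- move=> a /ereal_sup_gt[_ [y Ay <-] ay].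
  (* The gap [b - a] will absorb the correction [K / c]; [g y] may be [+oo], hence the two choices
     of [b]. *)
  have [b ab by_] : exists2 b : R, a < b & (b%:E < g y)%E.
    case: (g y) ay => [r|_|//]; last by exists (a + 1); rewrite ?ltry ?ltrDl.
    by rewrite lte_fin => ar; exists ((a + r) / 2); rewrite ?lte_fin; lra.
  pose U := interior A `&` [set z | (b%:E < g z)%E].
  have /lower_semicontinuousP/(_ b) bopen := glsc.
  have oU : open U by apply: openI => //; exact: open_interior.
  (* The point [y] lies in the closure of the interior of [A], and [{g > b}] is a neighbourhood of
     it. *)
  have U0 : U !=set0.
    by move: Ay; rewrite A_regular; apply; exact: open_nbhs_nbhs.
  have UA : U `<=` A by move=> z [/interior_subset].
  pose K := ln (fine (gamma U)).
  near=> c; have c0 : 0 < c by near: c; exact: nbhs_pinfty_gt.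
  rewrite LE//.
  apply: (@lt_le_trans _ _ (b + c^-1 * K)%:E); last first.
    apply: log_laplace_ge => //.
    - exact: mexp.
    - exact: sub_gen_smallest.
    - exact: gamma_open.
    - by move=> z [_ /ltW].
  (* This threshold is equivalent to [a < b + K / c]. *)
  have : - K / (b - a) < c by near: c; apply: nbhs_pinfty_gt; exact: num_real.
  rewrite ltr_pdivrMr ?subr_gt0// => Kc.
  by rewrite lte_fin -ltrBlDl ltr_pdivlMl//; lra.
Unshelve. all: by end_near. Qed.
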